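(* Let $\rho_0\in \mathrm{L}^\infty(\mathbb{R})$ satisfy $0\le\rho_0\le 1$ and $\mathrm{TV}(\rho_0)<+\infty$, and let $V\in\mathrm{Lip}([0,1])$ be a real-valued Lipschitz function with $V'\le 0$ in $[0,1]$. Let $\varepsilon,h>0$ and let the quadrature weights $\{\gamma_k^{\varepsilon,h}\}_{k\ge0}$ satisfy $\gamma_k^{\varepsilon,h}\ge\gamma_{k+1}^{\varepsilon,h}\ge 0$ for all $k\ge 0$ and $\sum_{k=0}^\infty\gamma_k^{\varepsilon,h}=1$. Assume the CFL condition $\lambda\big(\|V\|_{\mathrm{L}^\infty}+\|V'\|_{\mathrm{L}^\infty}\big)\le 1$. Let $\{\rho_j^n\}_{j\in\mathbb{Z}}^{n\ge 0}$ and $\{W_j^n\}_{j\in\mathbb{Z}}^{n\ge 0}$ be the numerical solutions produced by the scheme described in the context. Then, for all $c\in\mathbb{R}$ (and all $j\in\mathbb{Z}$, $n\ge 0$), $$\frac{|W_j^{n+1}-c|-|W_j^n-c|}{\tau}+\frac{\Psi_{j+1/2}^n-\Psi_{j-1/2}^n}{h}\le 0,$$ where $$\Psi_{j-1/2}^n=|W_{j-1}^n-c|\,V(c)-\sum_{k=0}^\infty\gamma_k^{\varepsilon,h}\,\rho_{j+k-1}^n\,\big|V(W_{j+k}^n)-V(c)\big| .$$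
   Context: Numerical scheme: let $\varepsilon>0$ be the nonlocal horizon parameter, $h>0$ the spatial mesh size, $\tau>0$ the time step, and $\lambda=\tau/h$ the CFL ratio. Given weights $\{\gamma_k^{\varepsilon,h}\}_{k\ge0}$, define, for $j\in\mathbb{Z}$ and $n\ge 0$, $$\rho_j^0=\frac1h\int_{(j-\frac12)h}^{(j+\frac12)h}\rho_0(x)\,dx,\qquad W_j^n=\sum_{k=0}^\infty\gamma_k^{\varepsilon,h}\rho_{j+k}^n,\qquad \rho_j^{n+1}=\rho_j^n+\lambda\big(\rho_{j-1}^nV(W_j^n)-\rho_j^nV(W_{j+1}^n)\big).$$ $\mathrm{TV}$ is the total variation over $\mathbb{R}$; $\|V\|_{\mathrm{L}^\infty}$ and $\|V'\|_{\mathrm{L}^\infty}$ are norms over $[0,1]$.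
   Formalization: It is additionally assumed that V ≥ 0 on [0,1] (the claim fails for V = -1), and, since V(c) is undefined for c outside [0,1], V(c) there is any value with V(c) ≤ V(1) if c > 1 and V(c) ≥ V(0) if c < 0. *)

(* Defs.v *)
From HB Require Import structures.
From mathcomp Require Import all_boot all_order all_algebra.
From mathcomp Require Import all_classical all_reals all_analysis.

Set Implicit Arguments.
Unset Strict Implicit.
Unset Printing Implicit Defensive.

Import Order.TTheory GRing.Theory Num.Theory.
Import numFieldNormedType.Exports.

Local Open Scope classical_set_scope.
Local Open Scope ring_scope.

Section TotalVariation.
Context {R : realType}.
Implicit Types f g : R -> R.

Definition pointwise_TV f : \bar R :=
  ereal_sup [set total_variation ab.1 ab.2 f
            | ab in [set ab : R * R | ab.1 <= ab.2]].

(* An element of L^oo is a function up to a null set, so its total variation is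
   the infimum of the pointwise variation over all its representatives. *)
Definition TV f : \bar R :=
  ereal_inf [set pointwise_TV g
            | g in [set g | {ae lebesgue_measure, forall x, g x = f x}]].

End TotalVariation.

(* L^oo([0, 1]) norm: f \_ D extends f by 0 outside D.  At points where a
   Lipschitz V is not differentiable, derive1 V has an unspecified value; these
   points form a null set and do not affect the norm of derive1 V. *)
Definition Linfty_norm01 {R : realType} (f : R -> R) : \bar R :=
  'N[lebesgue_measure]_+oo[EFin \o (f \_ `[0, 1])].

Section Scheme.
Context {R : realType}.
Variables (V rho0 : R -> R) (gamma : nat -> R) (h tau : R).

Definition cell_average (j : int) : R :=
  h^-1 * \int[lebesgue_measure]_(x in `[(j%:~R - 2^-1) * h,
                                        (j%:~R + 2^-1) * h]) rho0 x.

Definition nonlocal_average (u : int -> R) (j : int) : R :=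
  limn (series (fun k : nat => gamma k * u (j + k%:Z))).

Fixpoint rho (n : nat) : int -> R :=
  if n is m.+1 then fun j =>
    rho m j + tau / h * (rho m (j - 1) * V (nonlocal_average (rho m) j)
                         - rho m j * V (nonlocal_average (rho m) (j + 1)))
  else cell_average.

Definition W (n : nat) : int -> R := nonlocal_average (rho n).

(* Numerical entropy flux, indexed by the right cell of the interface:
   Psi c n j is the flux at the interface j - 1/2. *)
Definition Psi (c : R) (n : nat) (j : int) : R :=
  `|W n (j - 1) - c| * V c
  - limn (series (fun k : nat =>
      gamma k * rho n (j + k%:Z - 1) * `|V (W n (j + k%:Z)) - V c|)).

End Scheme.

(* Main.v *)
(* Abel summation turns the antitone weights into nonnegative ones: with
   d_k = gamma_k - gamma_(k+1), e_i = rho_(i-1) (V(W_i) - V(c)), lam = tau / h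
   and T = sum_k d_k e_(j+k+1), the scheme for W reads
     W_j' - c = [(1 - lam V(c)) (W_j - c) + lam gamma_0 e_j]
                + lam V(c) (W_(j-1) - c) - lam T.
   For c in [0, 1], V is nonincreasing and the CFL condition makes the first
   term of the bracket dominate the second, which has the opposite sign; so the
   bracket has absolute value
     (1 - lam V(c)) |W_j - c| - lam gamma_0 rho_(j-1) |V(W_j) - V(c)|,
   and the triangle inequality gives the claim.  For c outside [0, 1], V(c) may
   be negative, but W - c and e have constant signs and equality holds.
   Monotonicity and the Lipschitz bound of V are only given through the a.e.
   derivative; they are recovered by applying Radon-Nikodym and Lebesgue
   differentiation to the Stieltjes measure of x |-> (V(x) / K + x) / 2, where K
   is a Lipschitz constant. *)
Require Import Defs.
From HB Require Import structures.
From mathcomp Require Import all_boot all_order all_algebra.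
From mathcomp Require Import all_classical all_reals all_analysis.
From mathcomp Require Import ess_sup_inf measurable_realfun.
From mathcomp Require Import ring lra.

Set Implicit Arguments.
Unset Strict Implicit.
Unset Printing Implicit Defensive.

Import Order.TTheory GRing.Theory Num.Theory.
Import numFieldNormedType.Exports.

Local Open Scope classical_set_scope.
Local Open Scope ring_scope.

(** * Lipschitz functions and their almost everywhere derivative *)

Lemma ae_imply d (T : measurableType d) (R : realType)
    (mu : {measure set T -> \bar R}) (P Q : set T) :
  P `<=` Q -> {ae mu, forall x, P x} -> {ae mu, forall x, Q x}.
Proof.
move=> PQ [N [mN N0 PN]]; exists N; split => // x /= nQ.
by apply: PN => /= Px; exact/nQ/PQ.
Qed.

Lemma lebesgue_stieltjes_itv_oc (R : realType) (F : cumulative R R) (a b : R) :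
  a <= b -> lebesgue_stieltjes_measure F `]a, b] = (F b - F a)%:E.
Proof.
move=> ab; rewrite /lebesgue_stieltjes_measure /measure_extension.
by rewrite measurable_mu_extE/= ?wlength_itv_bnd//; exact: is_ocitv.
Qed.

Lemma ae_le_Rintegral d (T : measurableType d) (R : realType)
    (mu : {measure set T -> \bar R}) (D : set T) (f g : T -> R) :
  measurable D ->
  mu.-integrable D (EFin \o f) -> mu.-integrable D (EFin \o g) ->
  {ae mu, forall x, D x -> f x <= g x} ->
  \int[mu]_(x in D) f x <= \int[mu]_(x in D) g x.
Proof.
move=> mD intf intg [N [mN N0 fgN]].
rewrite /Rintegral (negligible_integral mN mD intf N0).
rewrite (negligible_integral mN mD intg N0).
have mDN : measurable (D `\` N) by exact: measurableD.
apply: (le_Rintegral mDN).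
- exact: integrableS intf.
- exact: integrableS intg.
- move=> x [Dx Nx]; apply: contrapT => fgx; apply: Nx; apply: fgN => /=.
  by move=> /(_ Dx).
Qed.
(** On each []x, y]] the Stieltjes measures of [F] and [G] add up to the length, so their sum is
    Lebesgue measure by uniqueness, and the [G] part is nonnegative. *)
Lemma lebesgue_stieltjes_le_lebesgue (R : realType) (F G : cumulative R R) :
  (forall x, F x + G x = x) ->
  forall A, measurable A ->
    (lebesgue_stieltjes_measure F A <= lebesgue_measure A)%E.
Proof.
move=> FG A mA.
pose nu := measure_add (lebesgue_stieltjes_measure F)
                       (lebesgue_stieltjes_measure G).
have nuE X : nu X = (lebesgue_stieltjes_measure F X
                     + lebesgue_stieltjes_measure G X)%E.
  by rewrite /nu measure_addE.
suff -> : lebesgue_measure A = nu A by rewrite nuE leeDl.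
apply: lebesgue_measure_unique mA => X.
move=> /ocitvP[->|[x xlt ->]]; first by rewrite !measure0.
rewrite [RHS]nuE !lebesgue_stieltjes_itv_oc ?ltW//.
rewrite lebesgue_measure_itv/= lte_fin xlt.
by rewrite -!EFinD -[in LHS](FG x.2) -[in LHS](FG x.1); congr EFin; ring.
Qed.

(* The Stieltjes measure of F is at most Lebesgue measure, because adding that
   of [x - F x] gives Lebesgue measure.  Its density is F' almost everywhere. *)
Lemma le_increment_of_ae_derive (R : realType) (F : R -> R) (a b M : R) :
  {homo F : x y / x <= y} -> {homo (fun x => x - F x) : x y / x <= y} ->
  a < b ->
  {ae lebesgue_measure, forall x, a < x < b -> derivable F x 1 ->
     derive1 F x <= M} ->
  F b - F a <= M * (b - a).
Proof.
move=> ndF ndG ab F'M.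
(* Since [F] and [x - F x] are both nondecreasing, [F] is 1-Lipschitz. *)
have cF : continuous F.
  move=> x; apply/cvgrPdist_le => /= e e0; near=> y.
  have : `|x - y| <= e by near: y; apply: cvgr_dist_le.
  case: (leP x y) => [xy|/ltW yx].
    move: (ndF _ _ xy) (ndG _ _ xy) => /= Fxy Gxy.
    by rewrite !ler0_norm; lra.
  move: (ndF _ _ yx) (ndG _ _ yx) => /= Fyx Gyx.
  by rewrite !ger0_norm; lra.
have cG : continuous (fun x => x - F x).
  by move=> x; apply: cvgB => //; exact: cF.
pose mF := isCumulative.Build R _ R F ndF (right_continuousW cF).
pose mG := isCumulative.Build R _ R (fun x => x - F x) ndG
  (right_continuousW cG).
pose cuF : cumulative R R := HB.pack F mF.
pose cuG : cumulative R R := HB.pack (fun x => x - F x) mG.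
have mab : measurable (`]a, b] : set (measurableTypeR R)) by [].
pose lsF := lebesgue_stieltjes_measure cuF.
have lsFab : (lsF `]a, b]%classic < +oo)%E.
  by rewrite /lsF lebesgue_stieltjes_itv_oc ?ltW// ltry.
(* Restricting to []a, b]] gives a finite measure, to which Radon-Nikodym is applied. *)
pose nu : {finite_measure set (measurableTypeR R) -> \bar R} :=
  mfrestr mab lsFab.
have nule A : measurable A -> (nu A <= lebesgue_measure A)%E.
  move=> mA; rewrite /nu/= /mfrestr /mrestr.
  apply: (@le_trans _ _ (lsF A)).
    by apply: le_measure; rewrite ?inE//; exact: measurableI.
  apply: (@lebesgue_stieltjes_le_lebesgue _ cuF cuG) => // x /=.
  by rewrite addrC subrK.
have nudom : nu `<< (@lebesgue_measure R).
  apply/null_content_dominatesP => A mA A0; apply/eqP.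
  by rewrite -measure_le0 -A0; exact: nule.
have [f [f0 ffin intf nuf]] := radon_nikodym_sigma_finite nudom.
pose g x := fine (f x).
have intg : (@lebesgue_measure R).-integrable setT (EFin \o g).
  by apply: eq_integrable intf => // x _; rewrite /g /= fineK.
have Fg x : x \in `[a, b] ->
    F x - F a = \int[lebesgue_measure]_(t in `]a, x]) g t.
  rewrite in_itv/= => /andP[ax xb].
  rewrite /Rintegral (eq_integral f); last by move=> t _; rewrite /g fineK.
  rewrite -nuf; last exact: measurable_itv.
  rewrite /nu/= /mfrestr /mrestr (_ : _ `&` _ = `]a, x]%classic).
    by rewrite /lsF lebesgue_stieltjes_itv_oc.
  by apply/setIidl/subset_itvl; rewrite bnd_simp.
have locg : locally_integrable setT g.
  by apply: open_integrable_locally => //; exact: openT.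
(* At a Lebesgue point of [g] its primitive has derivative [g x]. Near [x] that primitive differs
   from [F] by the constant [F a], so [F] is derivable there and the hypothesis on [derive1 F]
   applies. *)
have gM : {ae lebesgue_measure, forall x, `]a, b[%classic x -> g x <= M}.
  have := lebesgue_differentiation locg; near_simpl.
  move: F'M; apply: (@filterS2 _ _
    (ae_filter_ringOfSetsType (@lebesgue_measure R))).
  move=> x F'x gx /=; rewrite in_itv/= => axb.
  have [ax xb] := andP axb.
  have [dP DP] : derivable (fun y => \int[lebesgue_measure]_(t in `]a, y]) g t) x 1
    /\ derive1 (fun y => \int[lebesgue_measure]_(t in `]a, y]) g t) x = g x.
    apply: (@FTC1_lebesgue_pt _ _ (BRight a) x (x + 1)) => //.
    - by rewrite ltrDl.
    - exact: integrableS intg.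
  have isd : is_derive x 1 F (g x).
    apply: (@near_eq_is_derive _ _ _
      (fun y => \int[lebesgue_measure]_(t in `]a, y]) g t + F a)).
      near=> y; rewrite -Fg ?subrK// in_itv/=.
      have : y \in `]a, b[ by near: y; exact: near_in_itvoo.
      by rewrite in_itv/= => /andP[/ltW -> /ltW ->].
    rewrite -[g x]addr0; apply: is_deriveD.
    by rewrite -DP derive1E; exact: derivableP.
  have [dF DF] := isd.
  by rewrite -DF -derive1E; exact: F'x.
have -> : F b - F a = \int[lebesgue_measure]_(t in `]a, b[) g t.
  rewrite Fg; last by rewrite in_itv/= lexx ltW.
  by rewrite (@Rintegral_itv_bndo_bndc R (BRight a))//; exact: integrableS intg.
apply: (@le_trans _ _ (\int[lebesgue_measure]_(t in `]a, b[) M)).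
  apply: ae_le_Rintegral => //.
  - exact: integrableS intg.
  - have : (@lebesgue_measure R).-integrable `[a, b] (EFin \o cst M).
      apply: continuous_compact_integrable; first exact: segment_compact.
      by apply: continuous_subspaceT => x; exact: cvg_cst.
    by apply: integrableS => //; exact: subset_itvW.
rewrite Rintegral_cst//= lebesgue_measure_itv/= lte_fin ab.
by rewrite -EFinB.
Unshelve. all: by end_near. Qed.

(** As [f / K] is 1-Lipschitz, its mean [F] with the identity makes both [F] and [x - F x]
    nondecreasing, which reduces to the previous lemma. *)
Lemma lipschitz_increment_of_ae_derive (R : realType) (f : R -> R)
    (L a b M : R) :
  (forall x y, `|f x - f y| <= L * `|x - y|) -> a < b ->
  {ae lebesgue_measure, forall x, a < x < b -> derivable f x 1 ->
     derive1 f x <= M} ->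
  f b - f a <= M * (b - a).
Proof.
move=> lipf ab f'M.
(* The added 1 keeps [K] positive for every real [L]. *)
pose K := `|L| + 1; have K0 : 0 < K by rewrite /K ltr_wpDl.
have lipK x y : x <= y -> `|f y - f x| <= K * (y - x).
  move=> xy; apply: (le_trans (lipf _ _)); rewrite ger0_norm ?subr_ge0//.
  by apply: ler_wpM2r; rewrite ?subr_ge0// /K (le_trans (ler_norm L))// lerDl.
pose F x := (f x / K + x) / 2.
have fE : f = (fun x => K * (2 * F x - x)).
  by apply/funext => x; rewrite /F; field; rewrite gt_eqF.
have step x y : x <= y -> `|f y / K - f x / K| <= y - x.
  move=> xy; rewrite -mulrBl normrM normfV (gtr0_norm K0) ler_pdivrMr//.
  by rewrite mulrC lipK.
have : F b - F a <= (M / K + 1) / 2 * (b - a).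
  apply: le_increment_of_ae_derive; [| |exact: ab|].
  - by move=> x y /step; rewrite ler_norml /F; lra.
  - by move=> x y /step; rewrite ler_norml /F; lra.
  apply: ae_imply f'M.
  move=> x f'x axb /derivableP dF.
  have df : is_derive x 1 f (K * (2 * 'D_1 F x - 1)).
    rewrite fE; have d2F := is_deriveZ 2 dF.
    exact: (is_deriveZ K (is_deriveB d2F (is_derive_id x 1))).
  have [{}df Df] := df.
  have := f'x axb df; rewrite !derive1E Df -ler_pdivlMl//.
  by rewrite mulrC; lra.
rewrite /F => Fba.
have -> : f b - f a =
    K * ((f b / K + b) / 2 - (f a / K + a) / 2) * 2 - K * (b - a).
  by field; rewrite gt_eqF.
have -> : M * (b - a) = K * ((M / K + 1) / 2 * (b - a)) * 2 - K * (b - a).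
  by field; rewrite gt_eqF.
by rewrite lerD2r ler_pM2r// ler_pM2l.
Qed.

(** Composing [f] with the projection onto [[x, y]] gives a globally Lipschitz function. It
    coincides with [f] near each point of []x, y[], so the derivative bound carries over. *)
Lemma lipschitz_in_increment_of_ae_derive (R : realType) (f : R -> R)
    (L a b M : R) :
  {in `[a, b] &, forall x y, `|f x - f y| <= L * `|x - y|} ->
  {ae lebesgue_measure, forall x, a < x < b -> derivable f x 1 ->
     derive1 f x <= M} ->
  {in `[a, b] &, forall x y, x <= y -> f y - f x <= M * (y - x)}.
Proof.
move=> lipf f'M x y xab yab; rewrite le_eqVlt => /predU1P[->|xy].
  by rewrite !subrr mulr0.
pose clamp t := Num.max x (Num.min t y).
have clampE t : x <= t <= y -> clamp t = t.
  by move=> /andP[xt ty]; rewrite /clamp (min_l ty) (max_r xt).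
have clampI t : clamp t \in `[a, b].
  move: xab yab; rewrite !in_itv/= => /andP[ax xb] /andP[ay yb].
  by rewrite le_max ax ge_max xb ge_min yb orbT.
have clamp_mono s t : s <= t -> 0 <= clamp t - clamp s <= t - s.
  move=> st; rewrite /clamp.
  by case: (leP s y) => sy; case: (leP t y) => ty;
    rewrite ?(max_l (ltW xy)) ?(max_r (ltW xy));
    case: (leP x s) => xs; case: (leP x t) => xt; lra.
have clamp1 s t : `|clamp s - clamp t| <= `|s - t|.
  have [st|/ltW ts] := leP s t.
    have /andP[c0 c1] := clamp_mono _ _ st.
    by rewrite distrC [leRHS]distrC (ger0_norm c0) ger0_norm ?subr_ge0.
  have /andP[c0 c1] := clamp_mono _ _ ts.
  by rewrite (ger0_norm c0) ger0_norm ?subr_ge0.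
have L0 : 0 <= L.
  have := lipf _ _ xab yab.
  rewrite [`|x - y|]distrC [`|y - x|]gtr0_norm ?subr_gt0//.
  by move=> /(le_trans (normr_ge0 _)); rewrite pmulr_lge0 ?subr_gt0.
suff : (f \o clamp) y - (f \o clamp) x <= M * (y - x).
  by rewrite /= !clampE// lexx ltW.
apply: (@lipschitz_increment_of_ae_derive _ _ L) => [s t|//|].
  by rewrite (le_trans (lipf _ _ (clampI s) (clampI t)))// ler_wpM2l.
apply: ae_imply f'M.
move=> z f'z /andP[xz zy] dfc.
have fnear : \forall t \near z, (f \o clamp) t = f t.
  near=> t => /=; rewrite clampE//.
  have : t \in `]x, y[ by near: t; apply: near_in_itvoo; rewrite in_itv/= xz.
  by rewrite in_itv/= => /andP[/ltW -> /ltW ->].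
rewrite derive1E (near_eq_derive _ fnear) -derive1E; apply: f'z.
  move: xab yab; rewrite !in_itv/= => /andP[ax xb] /andP[ay yb].
  by rewrite (le_lt_trans ax)// (lt_le_trans zy).
exact: near_eq_derivable dfc.
Unshelve. all: by end_near. Qed.

(** A nondegenerate interval has positive measure, so no null set contains it. *)
Lemma ae_lebesgue_itv_witness (R : realType) (P : set R) (a b : R) : a < b ->
  {ae lebesgue_measure, forall x, P x} -> exists2 x, a < x < b & P x.
Proof.
move=> ab [N [mN N0 PN]]; apply: contrapT => noP.
have : (lebesgue_measure `]a, b[%classic <= lebesgue_measure N)%E.
  apply: le_measure; rewrite ?inE//.
  move=> x /=; rewrite in_itv/= => axb; apply: PN => /= Px.
  by apply: noP; exists x.
by rewrite N0 lebesgue_measure_itv/= lte_fin ab -EFinB lee_fin leNgt subr_gt0 ab.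
Qed.

Lemma Linfty_norm01_ae_le (R : realType) (f : R -> R) (N : R) :
  (Linfty_norm01 f <= N%:E)%E ->
  {ae lebesgue_measure, forall x, 0 <= x <= 1 -> `|f x| <= N}.
Proof.
(* The norm at exponent [+oo] unfolds to the essential supremum only when the whole space has
   positive measure. *)
have mu_gt0 : (0 < @lebesgue_measure R [set: R])%E.
  apply: (@lt_le_trans _ _ (lebesgue_measure (`[0, 1]%classic : set R))).
    by rewrite lebesgue_measure_itv/= lte_fin ltr01 oppr0 adde0 lte_fin.
  by apply: le_measure; rewrite ?inE.
rewrite /Linfty_norm01 unlock ifT// => /ess_supP fN.
apply: ae_imply fN => x /=; rewrite patchE => + x01.
by rewrite mem_set/= ?in_itv// lee_fin.
Qed.

(** * Averages with antitone weights *)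

Section WeightedAverage.
Context (R : realType) (w : nat -> R).
Hypotheses (w_ge0 : forall k, 0 <= w k) (w_cvg : cvgn (series w)).
Implicit Types (f g : int -> R) (j : int).

(** Comparison with [B *: w] gives absolute convergence. The linearity and order rules rely on it,
    since [limn] is meaningful only for convergent series. *)
Lemma is_cvg_nonlocal_average f j : (exists B, forall i, `|f i| <= B) ->
  cvgn (series (fun k : nat => w k * f (j + k%:Z))).
Proof.
move=> [B fB]; have B0 : 0 <= B by rewrite (le_trans _ (fB j)).
apply: normed_cvg; apply: (@series_le_cvg _ _ (B *: w)) => [k|k|k|].
- exact: normr_ge0.
- by rewrite mulr_ge0.
- by rewrite /= normrM (ger0_norm (w_ge0 k)) mulrC ler_wpM2r.
- exact: is_cvg_seriesZ.
Qed.

Lemma nonlocal_averageD f g j :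
  (exists B, forall i, `|f i| <= B) -> (exists B, forall i, `|g i| <= B) ->
  nonlocal_average w (fun i => f i + g i) j
  = nonlocal_average w f j + nonlocal_average w g j.
Proof.
move=> fB gB; rewrite /nonlocal_average -lim_seriesD;
  [|exact: is_cvg_nonlocal_average..].
by congr (limn (series _)); apply/funext => k; rewrite mulrDr.
Qed.

Lemma nonlocal_averageZ (a : R) f j : (exists B, forall i, `|f i| <= B) ->
  nonlocal_average w (fun i => a * f i) j = a * nonlocal_average w f j.
Proof.
move=> fB; rewrite /nonlocal_average -[RHS]lim_seriesZ;
  last exact: is_cvg_nonlocal_average.
by congr (limn (series _)); apply/funext => k; rewrite mulrCA.
Qed.

Lemma nonlocal_averageN f j : (exists B, forall i, `|f i| <= B) ->
  nonlocal_average w (fun i => - f i) j = - nonlocal_average w f j.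
Proof.
move=> fB; rewrite -mulN1r -nonlocal_averageZ//.
by congr nonlocal_average; apply/funext => i; rewrite mulN1r.
Qed.

Lemma nonlocal_average_cst (a : R) j :
  nonlocal_average w (fun=> a) j = a * limn (series w).
Proof.
rewrite -[RHS]lim_seriesZ// /nonlocal_average.
by congr (limn (series _)); apply/funext => k; rewrite mulrC.
Qed.

Lemma nonlocal_average_shift f j :
  nonlocal_average w (fun i => f (i + 1)) j = nonlocal_average w f (j + 1).
Proof.
by congr (limn (series _)); apply/funext => k; rewrite addrAC.
Qed.

Lemma le_nonlocal_average f g j :
  (exists B, forall i, `|f i| <= B) -> (exists B, forall i, `|g i| <= B) ->
  (forall i, f i <= g i) -> nonlocal_average w f j <= nonlocal_average w g j.
Proof.
move=> fB gB fg; apply: lim_series_le; try exact: is_cvg_nonlocal_average.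
by move=> k; rewrite ler_wpM2l.
Qed.

Lemma ler_norm_nonlocal_average f j : (exists B, forall i, `|f i| <= B) ->
  `|nonlocal_average w f j| <= nonlocal_average w (fun i => `|f i|) j.
Proof.
move=> fB; have nfB : exists B, forall i, `|(`|f i|)| <= B.
  by have [B fB'] := fB; exists B => i; rewrite normr_id.
rewrite ler_norml lerNl -nonlocal_averageN//; apply/andP; split.
  apply: le_nonlocal_average => // [|i].
    by have [B fB'] := fB; exists B => i; rewrite normrN.
  by rewrite lerNl; have := lerNnormlW (lexx `|f i|).
by apply: le_nonlocal_average => // i; exact: ler_norm.
Qed.

End WeightedAverage.

(** * Summation by parts for antitone weights *)

Section AbelSummation.
Context (R : realType) (gamma : nat -> R).
Hypotheses (gamma_mono : forall k, 0 <= gamma k.+1 <= gamma k)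
           (gamma_cvg : cvgn (series gamma)).

Let dgamma (k : nat) := gamma k - gamma k.+1.

Lemma antitone_weight_ge0 k : 0 <= gamma k.
Proof. by have /andP[/le_trans] := gamma_mono k; exact. Qed.

Lemma weight_decrement_ge0 k : 0 <= dgamma k.
Proof. by rewrite subr_ge0; have /andP[] := gamma_mono k. Qed.

Lemma is_cvg_weight_decrement : cvgn (series dgamma).
Proof.
apply: (@series_le_cvg _ _ gamma) => // [||k].
- exact: weight_decrement_ge0.
- exact: antitone_weight_ge0.
- by rewrite lerBlDr lerDl; have /andP[] := gamma_mono k.
Qed.

(** Shifting the partial sums moves the difference from [f] to the weights. Of the two boundary
    terms, [gamma 0 * f j] stays and [gamma n * f (j + n)] tends to 0 as the general term of a
    convergent series. *)
Lemma nonlocal_average_Abel (f : int -> R) (j : int) :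
  (exists B, forall i, `|f i| <= B) ->
  nonlocal_average gamma f (j + 1) - nonlocal_average gamma f j
  = nonlocal_average dgamma f (j + 1) - gamma 0 * f j.
Proof.
move=> fB.
have c0 := @is_cvg_nonlocal_average _ _ antitone_weight_ge0 gamma_cvg f j fB.
have c1 := @is_cvg_nonlocal_average _ _ antitone_weight_ge0 gamma_cvg f (j + 1) fB.
rewrite /nonlocal_average -[LHS]lim_seriesB//.
have cd := @is_cvg_nonlocal_average _ _ weight_decrement_ge0
  is_cvg_weight_decrement f (j + 1) fB.
apply: cvg_lim => //.
have -> : series ((fun k : nat => gamma k * f (j + 1 + k%:Z)) -
                  (fun k : nat => gamma k * f (j + k%:Z)))
  = fun n : nat => series (fun k : nat => dgamma k * f (j + 1 + k%:Z)) n
       + gamma n * f (j + n%:Z) - gamma 0 * f j.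
  set D := (fun k : nat => gamma k * f (j + 1 + k%:Z)) - _.
  have DE k : D k = gamma k * f (j + 1 + k%:Z) - gamma k * f (j + k%:Z) by [].
  apply/funext; elim => [|n IH].
    by rewrite /series/= !big_geq// addr0 add0r subrr.
  have jn : j + n.+1%:Z = j + 1 + n%:Z by rewrite -addrA -(PoszD 1).
  rewrite !seriesSr IH DE /dgamma jn.
  by ring.
apply: cvgB; last exact: cvg_cst.
rewrite -[X in _ --> X]addr0; apply: cvgD => //.
exact: cvg_series_cvg_0 c0.
Qed.

(** The Abel identity for the constant 1, whose left side vanishes. *)
Lemma lim_series_weight_decrement : limn (series dgamma) = gamma 0.
Proof.
have := @nonlocal_average_Abel (fun=> 1) 0.
rewrite (nonlocal_average_cst gamma_cvg) (nonlocal_average_cst gamma_cvg).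
rewrite (nonlocal_average_cst is_cvg_weight_decrement) subrr mulr1 mul1r.
move=> /(_ _)/esym/eqP; rewrite subr_eq0 => /(_ _)/eqP -> //.
by exists 1 => i; rewrite normr1.
Qed.

End AbelSummation.

(** * One time step *)

Section OneStep.
Context (R : realType) (gamma : nat -> R) (V : R -> R) (lam A M : R).
Hypotheses (gamma_mono : forall k, 0 <= gamma k.+1 <= gamma k)
           (gamma_sum : series gamma @ \oo --> (1 : R)).
Hypotheses (V_ge0 : forall x, 0 <= x <= 1 -> 0 <= V x)
           (V_leA : forall x, 0 <= x <= 1 -> V x <= A)
           (V_anti : {in `[0, 1] &, forall x y, x <= y -> V y <= V x})
           (V_lip : {in `[0, 1] &, forall x y, x <= y -> V x - V y <= M * (y - x)}).
Hypotheses (lam_ge0 : 0 <= lam) (M_ge0 : 0 <= M) (CFL : lam * (A + M) <= 1).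

Local Notation avg := (nonlocal_average gamma).
Local Notation davg := (nonlocal_average (fun k => gamma k - gamma k.+1)).

Let gamma_cvg : cvgn (series gamma). Proof. exact/cvgP/gamma_sum. Qed.
Let gamma_ge0 := antitone_weight_ge0 gamma_mono.
Let dgamma_ge0 := weight_decrement_ge0 gamma_mono.
Let dgamma_cvg := is_cvg_weight_decrement gamma_mono gamma_cvg.
Let lim_gamma : limn (series gamma) = 1. Proof. exact: cvg_lim gamma_sum. Qed.

Let bounded01 (f : int -> R) : (forall i, 0 <= f i <= 1) ->
  exists B, forall i, `|f i| <= B.
Proof.
by move=> f01; exists 1 => i; have /andP[f0 f1] := f01 i; rewrite ger0_norm.
Qed.

Lemma weight0_le1 : gamma 0%N <= 1.
Proof.
rewrite -lim_gamma; have -> : gamma 0%N = series gamma 1%N.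
  by rewrite /series/= big_nat1.
apply: nondecreasing_cvgn_le => //.
by apply: nondecreasing_series => k _ _; exact: gamma_ge0.
Qed.

Lemma nonlocal_average01 (u : int -> R) (j : int) :
  (forall i, 0 <= u i <= 1) -> 0 <= avg u j <= 1.
Proof.
move=> u01; have cB (a : R) : exists B, forall i : int, `|a| <= B by exists `|a|.
have := @nonlocal_average_cst _ gamma gamma_cvg; rewrite lim_gamma => cst_avg.
have lo : avg (fun=> 0) j <= avg u j.
  apply: (le_nonlocal_average gamma_ge0 gamma_cvg) => //; first exact: bounded01.
  by move=> i; case/andP: (u01 i).
have hi : avg u j <= avg (fun=> 1) j.
  apply: (le_nonlocal_average gamma_ge0 gamma_cvg) => //; first exact: bounded01.
  by move=> i; case/andP: (u01 i).
by move: lo hi; rewrite !cst_avg mul0r mul1r => -> ->.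
Qed.

(** The decrements have total mass [gamma 0] and [u] is at most 1. The factor [1 - u j] is what lets
    the upper bound of the scheme close at 1. *)
Lemma nonlocal_average_increment_le (u : int -> R) (j : int) :
  (forall i, 0 <= u i <= 1) ->
  avg u (j + 1) - avg u j <= gamma 0%N * (1 - u j).
Proof.
move=> u01; rewrite (nonlocal_average_Abel gamma_mono gamma_cvg)//;
  last exact: bounded01.
rewrite mulrBr mulr1 lerD2r -(lim_series_weight_decrement gamma_mono gamma_cvg).
rewrite -[X in _ <= X]mul1r -(nonlocal_average_cst dgamma_cvg 1 (j + 1)).
apply: (le_nonlocal_average dgamma_ge0 dgamma_cvg) => //.
- exact: bounded01.
- by exists 1 => i; rewrite normr1.
- by move=> i; case/andP: (u01 i).
Qed.

(** With [lam] equal to [tau / h], [rho m.+1] is convertible to this map applied to [rho m]. *)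
Definition scheme_step (u : int -> R) (j : int) : R :=
  u j + lam * (u (j - 1) * V (avg u j) - u j * V (avg u (j + 1))).

(** Maximum principle. Below, [u j] has the coefficient [1 - lam * V y], nonnegative by CFL; above,
    the gap to 1 is at least [(1 - lam * (A + M)) * (1 - u j)]. *)
Lemma scheme_step01 (u : int -> R) (j : int) :
  (forall i, 0 <= u i <= 1) -> 0 <= scheme_step u j <= 1.
Proof.
move=> u01; rewrite /scheme_step.
have W01 i := nonlocal_average01 i u01.
have [u0 u1] := andP (u01 j); have [v0 v1] := andP (u01 (j - 1)).
set x := avg u j; set y := avg u (j + 1).
have x01 : x \in `[0, 1] by rewrite in_itv; exact: W01.
have y01 : y \in `[0, 1] by rewrite in_itv; exact: W01.
have Vx0 : 0 <= V x by exact: V_ge0.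
have Vy0 : 0 <= V y by exact: V_ge0.
have VyA : V y <= A by exact: V_leA.
have lamVy : lam * V y <= 1.
  by apply: le_trans CFL; rewrite ler_wpM2l// (le_trans VyA)// lerDl.
apply/andP; split.
  have : 0 <= lam * (u (j - 1) * V x) by rewrite !mulr_ge0.
  have : 0 <= u j * (1 - lam * V y) by rewrite mulr_ge0// subr_ge0.
  by lra.
(* If the average increases, the Lipschitz bound meets the increment estimate with [gamma 0 <= 1];
   otherwise the left side is nonpositive. *)
have VxVy : V x - V y <= M * (1 - u j).
  have [xy|/ltW yx] := leP x y.
    apply: (le_trans (V_lip x01 y01 xy)).
    apply: ler_wpM2l => //; apply: (le_trans (nonlocal_average_increment_le _ u01)).
    by rewrite ler_piMl ?subr_ge0// weight0_le1.
  have : V x - V y <= 0 by rewrite subr_le0 V_anti.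
  by move=> /le_trans; apply; rewrite mulr_ge0// subr_ge0.
(* Replacing [u (j - 1)] by 1 bounds the update by [u j + lam * (V x - V y) + lam * V y * (1 - u
   j)]. *)
have h1 : lam * (u (j - 1) * V x) <= lam * V x.
  by rewrite ler_wpM2l// ler_piMl.
have h2 : lam * (V x - V y) <= lam * (M * (1 - u j)) by rewrite ler_wpM2l.
have h3 : lam * V y * (1 - u j) <= lam * A * (1 - u j).
  by rewrite ler_wpM2r ?subr_ge0// ler_wpM2l.
have h4 : lam * (A + M) * (1 - u j) <= 1 * (1 - u j).
  by rewrite ler_wpM2r ?subr_ge0.
by lra.
Qed.

(** This is [Psi] with its series written as an [avg], so that the averaging rules and Abel
    summation apply. *)
Definition entropy_flux (u : int -> R) (c : R) (i : int) : R :=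
  `|avg u (i - 1) - c| * V c
  - avg (fun l => u (l - 1) * `|V (avg u l) - V c|) i.

(** The claim is scaled by [tau]. [WE] and [QE] write the new average and the flux difference with
    matching Abel terms, and the position of [c] relative to [[0, 1]] settles the signs. *)
Lemma entropy_flux_step (u : int -> R) (c : R) (j : int) :
  (forall i, 0 <= u i <= 1) ->
  (1 < c -> V c <= V 1) -> (c < 0 -> V 0 <= V c) ->
  `|avg (scheme_step u) j - c| - `|avg u j - c|
    + lam * (entropy_flux u c (j + 1) - entropy_flux u c j) <= 0.
Proof.
move=> u01 Vc_right Vc_left; pose W := avg u; pose Q := entropy_flux u c.
rewrite -/(W j) -/(Q j) -/(Q (j + 1)).
have W01 i : 0 <= W i <= 1 := nonlocal_average01 i u01.
have W01' i : W i \in `[0, 1] by rewrite in_itv/= W01.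
have v01 i : 0 <= u (i - 1) <= 1 := u01 (i - 1).
pose e i := u (i - 1) * (V (W i) - V c).
pose g i := u (i - 1) * `|V (W i) - V c|.
have normVB i : `|V (W i) - V c| <= A + `|V c|.
  rewrite (le_trans (ler_normB _ _))// lerD2r ger0_norm; first exact: V_leA.
  exact: V_ge0.
have gE i : `|e i| = g i.
  by rewrite /e /g normrM ger0_norm//; case/andP: (v01 i).
have gle i : g i <= A + `|V c|.
  have [v0 v1] := andP (v01 i).
  by rewrite (le_trans _ (normVB i))// ler_piMl.
have eB : exists B, forall i, `|e i| <= B by exists (A + `|V c|) => i; rewrite gE.
have gB : exists B, forall i, `|g i| <= B.
  by exists (A + `|V c|) => i; rewrite -gE normr_id gE.
have vB : exists B, forall i, `|u (i - 1)| <= B by exact: bounded01.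
have VcvB : exists B, forall i, `|V c * u (i - 1)| <= B.
  have [B vB'] := vB; exists (`|V c| * B) => i.
  by rewrite normrM ler_wpM2l.
(* The transport flux splits into the deviation [e] and a linear part with speed [V c], whose
   average produces [W (j - 1)]. *)
pose f i := e i + V c * u (i - 1).
have fE i : f i = u (i - 1) * V (W i) by rewrite /f /e; ring.
have fB : exists B, forall i, `|f i| <= B.
  have [B1 e1] := eB; have [B2 e2] := VcvB; exists (B1 + B2) => i.
  by rewrite (le_trans (ler_normD _ _))// lerD.
have vW i : avg (fun l => u (l - 1)) (i + 1) = W i.
  rewrite -nonlocal_average_shift; congr nonlocal_average.
  by apply/funext => l; rewrite addrK.
have avgf i : avg f i = avg e i + V c * avg (fun l => u (l - 1)) i.
  rewrite (nonlocal_averageD gamma_ge0 gamma_cvg)//.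
  by rewrite (nonlocal_averageZ gamma_ge0 gamma_cvg).
have vW' i : avg (fun l => u (l - 1)) i = W (i - 1) by rewrite -vW subrK.
set T := davg e (j + 1); set S := davg g (j + 1).
have AbelE : avg e (j + 1) - avg e j = T - gamma 0%N * e j.
  exact: nonlocal_average_Abel.
have AbelG : avg g (j + 1) - avg g j = S - gamma 0%N * g j.
  exact: nonlocal_average_Abel.
(* Nonnegative decrements allow the triangle inequality inside [davg]. *)
have TS : `|T| <= S.
  apply: (le_trans (ler_norm_nonlocal_average dgamma_ge0 dgamma_cvg _ eB)).
  by rewrite /S (_ : (fun i => `|e i|) = g)//; apply/funext.
have stepE : avg (scheme_step u) j = W j - lam * (avg f (j + 1) - avg f j).
  have -> : scheme_step u = (fun i => u i + lam * (f i + - f (i + 1))).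
    by apply/funext => i; rewrite /scheme_step !fE addrK.
  have f1B : exists B, forall i, `|f (i + 1)| <= B.
    by have [B fB'] := fB; exists B => i.
  have Nf1B : exists B, forall i, `|- f (i + 1)| <= B.
    by have [B fB'] := f1B; exists B => i; rewrite normrN.
  have dfB : exists B, forall i, `|f i + - f (i + 1)| <= B.
    have [B1 e1] := fB; have [B2 e2] := Nf1B; exists (B1 + B2) => i.
    by rewrite (le_trans (ler_normD _ _))// lerD.
  have ldfB : exists B, forall i, `|lam * (f i + - f (i + 1))| <= B.
    have [B dB] := dfB; exists (`|lam| * B) => i.
    by rewrite normrM ler_wpM2l.
  rewrite (nonlocal_averageD gamma_ge0 gamma_cvg j (bounded01 u01) ldfB).
  rewrite (nonlocal_averageZ gamma_ge0 gamma_cvg lam j dfB).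
  rewrite (nonlocal_averageD gamma_ge0 gamma_cvg j fB Nf1B).
  rewrite (nonlocal_averageN gamma_ge0 gamma_cvg j f1B) nonlocal_average_shift.
  by rewrite -/W; ring.
have WE : avg (scheme_step u) j - c =
    (1 - lam * V c) * (W j - c) + lam * gamma 0%N * e j
    + lam * V c * (W (j - 1) - c) - lam * T.
  rewrite stepE !avgf vW vW'.
  have -> : avg e (j + 1) = T - gamma 0%N * e j + avg e j by rewrite -AbelE subrK.
  by ring.
have QE : Q (j + 1) - Q j =
    `|W j - c| * V c - `|W (j - 1) - c| * V c - S + gamma 0%N * g j.
  rewrite /Q /entropy_flux addrK -/W -/g.
  have -> : avg g (j + 1) = S - gamma 0%N * g j + avg g j by rewrite -AbelG subrK.
  by ring.
have step01 : 0 <= avg (scheme_step u) j <= 1.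
  by apply: nonlocal_average01 => i; exact: scheme_step01.
(* Here [V (W i) <= V 0 <= V c], so every [e i] is nonpositive. Both old and new averages exceed
   [c], all absolute values open, and the two sides agree. *)
have [c0|c0] := ltP c 0.
  have gN i : g i = - e i.
    rewrite -gE ler0_norm// mulr_ge0_le0//; first by case/andP: (v01 i).
    rewrite subr_le0 (le_trans _ (Vc_left c0))// V_anti// ?in_itv/= ?lexx ?ler01//.
    by case/andP: (W01 i).
  have SN : S = - T.
    rewrite /S (_ : g = fun i => - e i); last exact/funext.
    by rewrite (nonlocal_averageN dgamma_ge0 dgamma_cvg).
  have Wc i : `|W i - c| = W i - c.
    by rewrite ger0_norm// subr_ge0 (le_trans (ltW c0))//; case/andP: (W01 i).
  rewrite ger0_norm; last first.
    by rewrite subr_ge0 (le_trans (ltW c0))//; case/andP: step01.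
  by rewrite QE WE !Wc SN gN le_eqVlt; apply/orP; left; apply/eqP; ring.
(* The mirror case: [V (W i) >= V 1 >= V c] and both averages lie below [c]. *)
have [c1|c1] := ltP 1 c.
  have gN i : g i = e i.
    rewrite -gE ger0_norm// mulr_ge0//; first by case/andP: (v01 i).
    rewrite subr_ge0 (le_trans (Vc_right c1))// V_anti// ?in_itv/= ?lexx ?ler01//.
    by case/andP: (W01 i).
  have SN : S = T by rewrite /S (_ : g = e)//; exact/funext.
  have Wc i : `|W i - c| = c - W i.
    rewrite distrC ger0_norm// subr_ge0 (le_trans _ (ltW c1))//.
    by case/andP: (W01 i).
  rewrite distrC ger0_norm; last first.
    by rewrite subr_ge0 (le_trans _ (ltW c1))//; case/andP: step01.
  rewrite -[c - avg _ _]opprB QE WE !Wc SN gN le_eqVlt.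
  by apply/orP; left; apply/eqP; ring.
have c01 : 0 <= c <= 1 by rewrite c0.
have c01' : c \in `[0, 1] by rewrite in_itv.
have Vc0 : 0 <= V c by exact: V_ge0.
have [v0 v1] := andP (v01 j).
have coef : lam * V c + lam * M <= 1.
  by apply: le_trans CFL; rewrite -mulrDr ler_wpM2l// lerD2r V_leA.
have g0v : 0 <= gamma 0%N * u (j - 1) <= 1.
  by rewrite mulr_ge0//= mulr_ile1// weight0_le1.
have main : `|(1 - lam * V c) * (W j - c) + lam * gamma 0%N * e j|
    <= (1 - lam * V c) * `|W j - c| - lam * gamma 0%N * g j.
  have eE : lam * gamma 0%N * e j =
      lam * (gamma 0%N * u (j - 1)) * (V (W j) - V c).
    by rewrite /e; ring.
  have gE' : lam * gamma 0%N * g j =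
      lam * (gamma 0%N * u (j - 1)) * `|V (W j) - V c|.
    by rewrite /g; ring.
  rewrite eE gE'; have := W01' j; move: (W j) (gamma 0%N * u (j - 1)) g0v => x a.
  move=> /andP[a0 a1] x01.
  (* Domination combines [a <= 1] with [lam * M <= 1 - lam * V c], that is, CFL with [V c <= A]. *)
  have bound y : 0 <= y -> lam * a * (M * y) <= (1 - lam * V c) * y.
    move=> y0; rewrite mulrA ler_wpM2r//.
    apply: (@le_trans _ _ (lam * M)); last by lra.
    by rewrite -mulrA ler_wpM2l// ler_piMl.
  have [xc|/ltW cx] := leP x c.
    have Vxc : 0 <= V x - V c by rewrite subr_ge0 V_anti.
    have Vlip := V_lip x01 c01' xc.
    have h1 : lam * a * (V x - V c) <= lam * a * (M * (c - x)).
      by rewrite ler_wpM2l// mulr_ge0.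
    have := bound (c - x); rewrite subr_ge0 => /(_ xc) h2.
    rewrite (ger0_norm Vxc) (distrC x c) [`|c - x|]ger0_norm ?subr_ge0//.
    rewrite ler0_norm; lra.
  have Vxc : 0 <= V c - V x by rewrite subr_ge0 V_anti.
  have Vlip := V_lip c01' x01 cx.
  have h1 : lam * a * (V c - V x) <= lam * a * (M * (x - c)).
    by rewrite ler_wpM2l// mulr_ge0.
  have := bound (x - c); rewrite subr_ge0 => /(_ cx) h2.
  rewrite (distrC (V x)) (ger0_norm Vxc) [`|x - c|]ger0_norm ?subr_ge0//.
  by rewrite ger0_norm; lra.
rewrite WE QE.
set X := (1 - lam * V c) * (W j - c) + lam * gamma 0%N * e j in main *.
(* Adding [lam] times the flux difference cancels [lam * S] and the [W (j - 1)] term; [main] absorbs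
   the rest. *)
have t1 : `|X + lam * V c * (W (j - 1) - c) - lam * T|
   <= `|X| + lam * V c * `|W (j - 1) - c| + lam * S.
  rewrite (le_trans (ler_normB _ _))// lerD//.
    rewrite (le_trans (ler_normD _ _))// lerD2l.
    by rewrite !normrM ger0_norm// (ger0_norm Vc0).
  by rewrite normrM ger0_norm// ler_wpM2l.
by lra.
Qed.

End OneStep.

(** * Initial data and the entropy inequality for the scheme *)

(** Membership in [Lfun] supplies measurability and the bound by 1 supplies integrability on the
    cell, whose length [h] is normalized away. *)
Lemma cell_average01 (R : realType) (rho0 : R -> R) (h : R) (j : int) :
  0 < h -> rho0 \in Lfun lebesgue_measure +oo%E ->
  {ae lebesgue_measure, forall x, 0 <= rho0 x <= 1} ->
  0 <= cell_average rho0 h j <= 1.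
Proof.
move=> h0 rho0L rho01; rewrite /cell_average.
set a := (j%:~R - 2^-1) * h; set b := (j%:~R + 2^-1) * h.
have ba : b - a = h by rewrite /a /b; field.
have ab : a < b by rewrite -subr_gt0 ba.
have mrho : measurable_fun setT rho0 by have := sub_Lfun_mfun rho0L; rewrite inE.
have icst (M : R) : (@lebesgue_measure R).-integrable `[a, b] (EFin \o cst M).
  apply: continuous_compact_integrable; first exact: segment_compact.
  by apply: continuous_subspaceT => x; exact: cvg_cst.
have irho : (@lebesgue_measure R).-integrable `[a, b] (EFin \o rho0).
  apply/integrableP; split.
    by apply/measurable_EFinP; exact: measurable_funS mrho.
  have /integrableP[_ ilt] := icst 1.
  apply: le_lt_trans ilt; apply: ae_ge0_le_integral => //.
  - by apply/measurable_EFinP/measurableT_comp => //; exact: measurable_funS mrho.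
  - by apply/measurable_EFinP/measurableT_comp.
  - apply: ae_imply rho01 => x /= /andP[r0 r1] _.
    by rewrite lee_fin !ger0_norm.
have cstE (M : R) : \int[lebesgue_measure]_(x in `[a, b]) cst M x = M * h.
  rewrite Rintegral_cst//= lebesgue_measure_itv/= lte_fin ab.
  by rewrite -EFinB /= ba.
have lo : \int[lebesgue_measure]_(x in `[a, b]) cst 0 x
    <= \int[lebesgue_measure]_(x in `[a, b]) rho0 x.
  apply: ae_le_Rintegral => //.
  by apply: ae_imply rho01 => x /= /andP[].
have hi : \int[lebesgue_measure]_(x in `[a, b]) rho0 x
    <= \int[lebesgue_measure]_(x in `[a, b]) cst 1 x.
  apply: ae_le_Rintegral => //.
  by apply: ae_imply rho01 => x /= /andP[].
move: lo hi; rewrite !cstE mul0r mul1r => lo hi.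
by apply/andP; split; rewrite ?ler_pdivrMl ?mulr1// mulr_ge0// invr_ge0 ltW.
Qed.

(* V is only constrained on [0, 1].  For c outside [0, 1], V c stands for the
   value at c of any extension of V that is still nonincreasing between [0, 1]
   and c; both conditions on V c are void when c is in [0, 1]. *)
Theorem lemma3p8 (R : realType) (rho0 V : R -> R)
    (gamma : R -> R -> nat -> R) (eps h tau : R)
    (rho0_Linfty : rho0 \in Lfun lebesgue_measure +oo%E)
    (rho0_01 : {ae lebesgue_measure, forall x, 0 <= rho0 x <= 1})
    (rho0_TV : (TV rho0 < +oo)%E)
    (V_lip : [lipschitz V x | x in `[0, 1]])
    (V_ge0 : forall x : R, 0 <= x <= 1 -> 0 <= V x)
    (V'_le0 : {ae lebesgue_measure, forall x : R, 0 <= x <= 1 -> derive1 V x <= 0})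
    (eps_gt0 : 0 < eps) (h_gt0 : 0 < h) (tau_gt0 : 0 < tau)
    (gamma_mono : forall k, 0 <= gamma eps h k.+1 <= gamma eps h k)
    (gamma_sum : series (gamma eps h) @ \oo --> (1 : R))
    (CFL : ((tau / h)%:E * (Linfty_norm01 V + Linfty_norm01 (derive1 V)) <= 1)%E)
    (c : R) (Vc_right : 1 < c -> V c <= V 1) (Vc_left : c < 0 -> V 0 <= V c)
    (n : nat) (j : int) :
  (`|W V rho0 (gamma eps h) h tau n.+1 j - c|
     - `|W V rho0 (gamma eps h) h tau n j - c|) / tau
  + (Psi V rho0 (gamma eps h) h tau c n (j + 1)
     - Psi V rho0 (gamma eps h) h tau c n j) / h <= 0.
Proof.
have lam0 : 0 < tau / h by exact: divr_gt0.
(* The Lipschitz predicate holds for all constants above some threshold [L]; the witness is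
   [L + 1]. *)
have [L V_klip] : exists L,
    {in `[0, 1] &, forall x y, `|V x - V y| <= L * `|x - y|}.
  case: V_lip => L [_ VL]; exists (L + 1) => x y x01 y01.
  by apply: (VL (L + 1) _ (x, y)); [rewrite ltrDl|split].
(* As [tau / h] is positive, an infinite norm would make the left side of [CFL] infinite; both norms
   are therefore real. *)
have [A [M [A0 M0 VA VM CFL']]] : exists A M, [/\ 0 <= A, 0 <= M,
    (Linfty_norm01 V <= A%:E)%E, (Linfty_norm01 (derive1 V) <= M%:E)%E &
    tau / h * (A + M) <= 1].
  have : (0 <= Linfty_norm01 V)%E by exact: Lnorm_ge0.
  have : (0 <= Linfty_norm01 (derive1 V))%E by exact: Lnorm_ge0.
  move: CFL; case: (Linfty_norm01 V) => [A| |];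
    case: (Linfty_norm01 (derive1 V)) => [M| |] //=.
  - by rewrite -EFinD -EFinM !lee_fin => lamAM M0 A0; exists A, M; split.
  - by rewrite gt0_muley ?lte_fin.
  - by rewrite gt0_muley ?lte_fin.
  - by rewrite gt0_muley ?lte_fin.
have V_inc (f : R -> R) := @lipschitz_in_increment_of_ae_derive R f L 0 1.
have V_anti : {in `[0, 1] &, forall x y, x <= y -> V y <= V x}.
  move=> x y x01 y01 xy; rewrite -subr_le0 -(mul0r (y - x)).
  apply: (V_inc V) => //; apply: ae_imply V'_le0 => z Vz /andP[z0 z1] _.
  by apply: Vz; rewrite !ltW.
have V_dec : {in `[0, 1] &, forall x y, x <= y -> V x - V y <= M * (y - x)}.
  move=> x y x01 y01 xy; rewrite -[V x]opprK addrC.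
  apply: (V_inc (fun t => - V t)) => //.
    by move=> s t s01 t01; rewrite opprK addrC distrC V_klip.
  apply: ae_imply (Linfty_norm01_ae_le VM) => z Vz /andP[z0 z1] dNV.
  have dV : derivable V z 1 by rewrite -[V](opprK V); exact: derivableN.
  rewrite derive1E deriveN// -derive1E.
  by rewrite (le_trans (ler_norm _))// normrN Vz// !ltW.
have i01 : (0 : R) \in `[0, 1] by rewrite in_itv/= lexx ler01.
(* The norm bounds [V] only almost everywhere, so the value at 0 is reached from a nearby good
   point: in [d], the 1 keeps it in [[0, 1]] and the quotient makes [L * x <= e]. Monotonicity then
   spreads the bound. *)
have V0A : V 0 <= A.
  apply/ler_addgt0Pr => e e0.
  pose d := Num.min 1 (e / (`|L| + 1)).
  have d0 : 0 < d by rewrite lt_min ltr01 divr_gt0// ltr_wpDl.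
  have [x /andP[x0 xd] Vx] := ae_lebesgue_itv_witness d0 (Linfty_norm01_ae_le VA).
  move: xd; rewrite lt_min => /andP[x1 xe].
  have x01 : x \in `[0, 1] by rewrite in_itv/= !ltW.
  have := V_klip _ _ i01 x01; rewrite sub0r normrN (gtr0_norm x0) => V0x.
  have VxA : V x <= A by rewrite (le_trans (ler_norm _))// Vx// !ltW.
  have Lx : L * x <= e.
    move: xe; rewrite ltr_pdivlMr ?ltr_wpDl// => /ltW; apply: le_trans.
    rewrite mulrC; apply: (ler_wpM2l (ltW x0)).
    by rewrite (le_trans (ler_norm L))// lerDl.
  by have := ler_norm (V 0 - V x); lra.
have V_leA x : 0 <= x <= 1 -> V x <= A.
  move=> x01; have [x0 _] := andP x01.
  by rewrite (le_trans (V_anti _ _ i01 _ x0)).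
have rho01 m i : 0 <= rho V rho0 (gamma eps h) h tau m i <= 1.
  elim: m i => [|m IH] i; first exact: cell_average01.
  exact: (scheme_step01 gamma_mono gamma_sum V_ge0 V_leA V_anti V_dec
    (ltW lam0) M0 CFL' i IH).
have := entropy_flux_step gamma_mono gamma_sum V_ge0 V_leA V_anti V_dec
  (ltW lam0) M0 CFL' j (rho01 n) Vc_right Vc_left.
have PsiE i : entropy_flux (gamma eps h) V (rho V rho0 (gamma eps h) h tau n) c i
    = Psi V rho0 (gamma eps h) h tau c n i.
  congr (_ - _); congr (limn (series _)); apply/funext => k.
  by rewrite mulrA.
rewrite !PsiE => entropy.
set p := `|_ - c| - `|_ - c| in entropy *.
set q := Psi _ _ _ _ _ _ _ _ - _ in entropy *.
(* Factoring out the positive [1 / tau] leaves the one-step inequality with [lam = tau / h]. *)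
have -> : p / tau + q / h = (p + tau / h * q) / tau by field; rewrite !gt_eqF.
by rewrite ler_pdivrMr// mul0r.
Qed.
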